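(* For functions $f:\underline{X}\to\underline{Y}$ and $g:\underline{U}\to\underline{V}$ between topological spaces, $f\leq_2 g$ implies $\operatorname{bas}(f)\leq\operatorname{bas}(g)$.
   Context: A partial function $F:\subseteq X\to Y$ is continuous if continuous on $\operatorname{dom}(F)$ with the subspace topology. $f\leq_2 g$ means there are continuous partial functions $F:\subseteq\underline{X}\times\underline{V}\to\underline{Y}$ and $G:\subseteq\underline{X}\to\underline{U}$ with $f(x)=F(x,g(G(x)))$ (all defined) for all $x\in X$. A partition for a function $f:\underline{X}\to\underline{Y}$ is a partition $p$ of $X$ such that $f|_U$ is continuous (subspace topology) for every $U\in p$. The Basesize $\operatorname{bas}(f)$ is the least cardinality of a partition for $f$. *)

(* Defs.v *)
From HB Require Import structures.
From mathcomp Require Import all_boot all_order all_algebra.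
From mathcomp Require Import all_classical.
From mathcomp Require Import topology.

Set Implicit Arguments.
Unset Strict Implicit.
Unset Printing Implicit Defensive.

Local Open Scope classical_set_scope.
Local Open Scope card_scope.

Record pfun (X Y : Type) := PFun {
  pdom : set X;
  papp : set_type pdom -> Y }.

Definition pvalue (X Y : Type) (F : pfun X Y) (x : X) (y : Y) : Prop :=
  exists x' : pdom F, set_val x' = x /\ papp x' = y.

(* [set_type (pdom F)] carries the subspace topology (the initial topology of
   the inclusion [set_val]). *)
Definition pcontinuous (X Y : topologicalType) (F : pfun X Y) : Prop :=
  continuous (@papp X Y F).

Definition le2 (X Y U V : topologicalType) (f : X -> Y) (g : U -> V) : Prop :=
  exists (F : pfun (X * V)%type Y) (G : pfun X U),
    [/\ pcontinuous F, pcontinuous G &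
        forall x, exists2 u, pvalue G x u & pvalue F (x, g u) (f x)].

(* [sigL A f] is the restriction of f to the subspace [set_type A]. *)
Definition partition_for (X Y : topologicalType) (f : X -> Y)
    (p : set (set X)) : Prop :=
  partition p id [set: X] /\ forall A, p A -> continuous (sigL A f).

Definition least_card (T : Type) (P : set (set T)) (A : set T) : Prop :=
  P A /\ forall B, P B -> A #<= B.

(* Apply Zorn's lemma to the sets of choice functions h (h B \in B for B in P)
   on which every evaluation h |-> h B is injective. *)
Lemma least_card_ex (T : Type) (P : set (set T)) :
  P !=set0 -> exists A, least_card P A.
Proof.
move=> [A0 PA0].
pose Q (I : set (set T -> T)) := forall B, P B ->
  (forall h, I h -> B (h B)) /\
  (forall h k, I h -> I k -> h B = k B -> h = k).
have [|I [QI maxI]] := @Zorn_bigcup _ Q.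
  move=> F FQ totF B PB; split=> [h [I FI Ih]|h k [I FI Ih] [J FJ Jk] hk].
    by have [+ _] := FQ _ FI _ PB; exact.
  case: (totF _ _ FI FJ) => [IJ|JI].
    by have [_ +] := FQ _ FJ _ PB; apply=> //; exact: IJ.
  by have [_ +] := FQ _ FI _ PB; apply=> //; exact: JI.
have [[A [PA IA]]|] :=
    pselect (exists A, P A /\ A `<=` [set h A | h in I]); last first.
  move=> nA.
  have ch B : P B -> exists b, B b /\ ~ [set h B | h in I] b.
    move=> PB; apply: contrapT => nb; apply: nA; exists B; split=> // b Bb.
    by apply: contrapT => nIb; apply: nb; exists b.
  have [t0 _] := ch _ PA0.
  have ch' B : exists b, P B -> B b /\ ~ [set h B | h in I] b.
    have [/ch[b Hb]|nPB] := pselect (P B); first by exists b.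
    by exists t0.
  have [k Pk] := choice ch'.
  exfalso; apply: (maxI (I `|` [set k])).
    split; first exact: subsetUl.
    move=> /(_ k (or_intror erefl)) Ik.
    by have [_] := Pk _ PA0; apply; exists k.
  move=> B PB; have [IB injB] := QI _ PB; have [kB nk] := Pk _ PB.
  split=> [h [/IB//|->//]|h h' [Ih|->] [Ih'|->] //].
  - exact: injB.
  - by move=> hk; exfalso; apply: nk; exists h.
  - by move=> hk; exfalso; apply: nk; exists h'.
exists A; split=> // B PB; have [IB injB] := QI _ PB.
apply: (@card_le_trans _ _ _ I).
  apply: (card_le_trans (subset_card_le IA)); exact: card_image_le.
have : [set h B | h in I] #<= B.
  by apply: subset_card_le => _ [h Ih <-]; exact: IB.
apply: card_le_trans; have := @inj_card_eq _ _ I (fun h => h B).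
rewrite card_eq_le => /(_ _)/andP[]// h h' /set_mem Ih /set_mem Ih'.
exact: injB.
Qed.

Lemma partition_for_ex (X Y : topologicalType) (f : X -> Y) :
  partition_for f !=set0.
Proof.
exists [set [set x] | x in [set: X]]; split; last first.
  by move=> _ [x _ <-]; apply/subspace_sigL_continuousP/continuous_subspace1.
split.
- by apply/seteqP; split=> // x _; exists [set x] => //; exists x.
- by move=> _ _ [x _ <-] [y _ <-] [z [/= -> ->]].
- by move=> _ [x _ <-]; exists x.
Qed.

(* A cardinal is represented by a set of that cardinality, here a partition for
   f of least cardinality, to be used only up to equipotence [#=]. *)
Definition bas (X Y : topologicalType) (f : X -> Y) : set (set X) :=
  projT1 (cid (least_card_ex (partition_for_ex f))).

Lemma basP (X Y : topologicalType) (f : X -> Y) :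
  least_card (partition_for f) (bas f).
Proof. by rewrite /bas; case: cid. Qed.

(* Main.v *)
(* The reduction provides a continuous [gam : X -> U] with
   [f x = F (x, g (gam x))]. On the preimage under [gam] of a set on which [g]
   is continuous, [f] is therefore continuous, so the nonempty preimages of the
   blocks of a partition for [g] form a partition for [f]. *)
Require Import Defs.
From mathcomp Require Import all_boot all_order all_algebra.
From mathcomp Require Import all_classical.
From mathcomp Require Import topology.

Set Implicit Arguments.
Unset Strict Implicit.
Unset Printing Implicit Defensive.

Local Open Scope classical_set_scope.
Local Open Scope card_scope.

Lemma continuous_set_type (T X : topologicalType) (A : set X)
    (h : T -> set_type A) :
  continuous (set_val \o h) -> continuous h.
Proof. exact: continuous_comp_initial. Qed.

Lemma continuous_set_val (X : topologicalType) (A : set X) :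
  continuous (set_val : set_type A -> X).
Proof. exact: initial_continuous. Qed.

Lemma continuous_pair (T X Y : topologicalType) (h : T -> X) (k : T -> Y) :
  continuous h -> continuous k -> continuous (fun t => (h t, k t)).
Proof. by move=> ch ck t; apply: cvg_pair; [exact: ch | exact: ck]. Qed.

(** Choice lifts [h] to a map [phi] into the domain of [F]. Since [set_val \o phi] is [h] and the
    domain carries the initial topology of [set_val], [phi] is continuous, and [k] is [papp] after
    [phi]. *)
Lemma pvalue_continuous (T X Y : topologicalType) (F : pfun X Y)
    (h : T -> X) (k : T -> Y) :
  pcontinuous F -> continuous h -> (forall t, pvalue F (h t) (k t)) ->
  continuous k.
Proof.
move=> cF ch Fhk; have [phi phiP] := choice Fhk.
have -> : k = @papp X Y F \o phi by apply/funext => t /=; case: (phiP t).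
move=> t; apply: continuous_comp; last exact: cF.
apply: continuous_set_type => //.
by rewrite (_ : _ \o _ = h)//; apply/funext => s /=; case: (phiP s).
Qed.

Lemma partition_for_le2 (X Y U V : topologicalType) (f : X -> Y) (g : U -> V)
    (p : set (set U)) :
  le2 f g -> partition_for g p -> exists2 q, partition_for f q & q #<= p.
Proof.
move=> [F [G [cF cG FG]]] [[cov triv _] cg].
have FG' x : exists u, pvalue G x u /\ pvalue F (x, g u) (f x).
  by have [u] := FG x; exists u.
have [gam gamP] := choice FG'.
have cgam : continuous gam.
  apply: (pvalue_continuous (h := id) cG) => [x|x]; first exact: cvg_id.
  by case: (gamP x).
(* [gam] need not be onto, so empty preimages are discarded; a subset of an image of [p] is no
   larger than [p]. *)
exists ([set gam @^-1` A | A in p] `&` [set B | B !=set0]); last first.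
  apply: (card_le_trans (subset_card_le (@subIsetl _ _ _))).
  exact: card_image_le.
split; first split.
- apply/seteqP; split=> // x _.
  have [A pA Agx] : cover p id (gam x) by rewrite cov.
  by exists (gam @^-1` A) => //; split; [exists A | exists x].
- move=> _ _ [[A pA <-] _] [[B pB <-] _] [x [/= Ax Bx]].
  by rewrite (triv A B pA pB)//; exists (gam x).
- by move=> B [].
move=> _ [[A pA <-] _].
pose B := gam @^-1` A.
have AB (b : set_type B) : gam (set_val b) \in A.
  by apply/mem_set; exact: (set_mem (valP b)).
(* [g] is continuous only as a map on the subspace [A], so [gam] restricted to [B] has to be
   corestricted to [A] before composing. *)
pose r (b : set_type B) : set_type A := SigSub (AB b).
have cr : continuous r.
  apply: continuous_set_type => b.
  apply: (@continuous_comp _ _ _ set_val gam); last exact: cgam.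
  exact: continuous_set_val.
have cgr : continuous (sigL A g \o r).
  by move=> b; apply: continuous_comp; [exact: cr | exact: cg].
(* On [B], [f] is the value of [F] along the continuous map sending [b] to [(b, g (gam b))]. *)
apply: (pvalue_continuous cF (continuous_pair (@continuous_set_val X B) cgr)).
by move=> b; have [_] := gamP (set_val b).
Qed.

Theorem theorem5p9 (X Y U V : topologicalType) (f : X -> Y) (g : U -> V) :
  le2 f g -> bas f #<= bas g.
Proof.
move=> fg; have [_ minf] := basP f; have [pg _] := basP g.
(* The partition pulled back is [bas g] itself; minimality of [bas f] then compares it with [q]. *)
have [q qf qg] := partition_for_le2 fg pg.
exact: card_le_trans (minf _ qf) qg.
Qed.
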